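(* For every $\mu>0$ there exist constants $0<c,\varepsilon\le 1$ and $n_0\in\mathbb N$ such that the following holds for all $n\ge n_0$. If $G$ is an $n$-vertex graph that is $\varepsilon n$-joined and has minimum degree $\delta(G)\ge \mu n$, then $G$ contains a spanning nearly-balanced $K_t$-subdivision for all integers $t$ with $2\le t\le c\sqrt{n}$.
   Context: For $m>0$, a graph $G$ is $m$-joined if for every pair of disjoint subsets $A,B\subseteq V(G)$ with $|A|=|B|=m$ there is an edge of $G$ between $A$ and $B$. For a graph $H$, an $H$-subdivision is a graph obtained from $H$ by replacing some (possibly all) edges of $H$ by paths, these paths being internally vertex-disjoint from each other and from the vertices of $H$; the images of the vertices of $H$ are the branch vertices and the paths replacing edges are the branching paths. A subdivision contained in $G$ is spanning if it uses all vertices of $G$. An $H$-subdivision is nearly-balanced if there is a positive integer $\ell$ such that every branching path has length between $\ell-1$ and $\ell+1$. $K_t$ denotes the complete graph on $t$ vertices. *)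

(* Defs.v *)
From HB Require Import structures.
From mathcomp Require Import all_boot all_order all_algebra.
From mathcomp Require Import reals.

Set Implicit Arguments.
Unset Strict Implicit.
Unset Printing Implicit Defensive.

(** Finite simple graphs with vertex set [V]. *)
Record sgraph (V : finType) := SGraph {
  adj :> rel V;
  adj_sym : symmetric adj;
  adj_irr : irreflexive adj }.

Definition deg (V : finType) (G : sgraph V) (v : V) : nat :=
  #|[set w | G v w]|.

(** Every degree is smaller than [#|V|], so the default value of the iterated
    minimum is only attained on the empty graph. *)
Definition min_degree (V : finType) (G : sgraph V) : nat :=
  \big[minn/#|V|]_(v : V) deg G v.

Definition joined (V : finType) (m : nat) (G : sgraph V) : Prop :=
  forall A B : {set V}, [disjoint A & B] -> #|A| = m -> #|B| = m ->
    exists x y, [/\ x \in A, y \in B & G x y].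

Definition complete_rel (t : nat) : rel 'I_t := fun i j => i != j.

Fact complete_sym t : symmetric (@complete_rel t).
Proof. by move=> i j; rewrite /complete_rel eq_sym. Qed.

Fact complete_irr t : irreflexive (@complete_rel t).
Proof. by move=> i; rewrite /complete_rel eqxx. Qed.

Definition complete (t : nat) : sgraph 'I_t :=
  SGraph (@complete_sym t) (@complete_irr t).

(** An [H]-subdivision contained in [G].  For an edge [uv] of [H], the sequence
    [inner u v] lists the internal vertices of the branching path replacing
    [uv], from [branch u] to [branch v]; it is empty when the edge is not
    subdivided.  The unordered edge [uv] carries one path, hence [inner_rev].
    The values of [inner] outside the edges of [H] are irrelevant. *)
Record subdivision (W V : finType) (H : sgraph W) (G : sgraph V) :=
  Subdivision {
    branch : W -> V;
    inner : W -> W -> seq V;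
    branch_inj : injective branch;
    inner_rev : forall u v, H u v -> inner v u = rev (inner u v);
    inner_path : forall u v, H u v ->
      path G (branch u) (rcons (inner u v) (branch v));
    inner_uniq : forall u v, H u v -> uniq (inner u v);
    inner_branch : forall u v w, H u v -> branch w \notin inner u v;
    inner_disjoint : forall u v u' v', H u v -> H u' v' ->
      [set u; v] != [set u'; v'] -> [disjoint inner u v & inner u' v'] }.

(** Number of edges of the branching path replacing [uv]. *)
Definition branch_length (W V : finType) (H : sgraph W) (G : sgraph V)
    (S : subdivision H G) (u v : W) : nat := (size (inner S u v)).+1.

Definition spanning (W V : finType) (H : sgraph W) (G : sgraph V)
    (S : subdivision H G) : Prop :=
  forall x : V, (exists w, x = branch S w) \/
                (exists u v, H u v /\ x \in inner S u v).

Definition nearly_balanced (W V : finType) (H : sgraph W) (G : sgraph V)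
    (S : subdivision H G) : Prop :=
  exists2 l : nat, 0 < l &
    forall u v, H u v -> l - 1 <= branch_length S u v <= l + 1.

Local Open Scope ring_scope.

(** [m]-joinedness is monotone in [m]; for a real parameter, rounding up makes
    it say that there is an edge between any two disjoint sets of size at least
    that parameter. *)
Definition ceil_nat (R : realType) (x : R) : nat := `|Num.ceil x|%N.

(* Main.v *)
Require Import Defs.
From mathcomp Require Import all_boot all_order all_algebra.
From mathcomp Require Import reals.
From mathcomp Require Import perm fingroup zify.

(** Proof idea, with [c], [eps] much smaller than [mu] and [K] the set of pairs [i < j].
    A random colouring provides a small reserve [Z], split into equal fibres
    indexed by [K], in which every vertex keeps linearly many neighbours.  Every
    vertex [z] of the fibre of [k] may be inserted into the path of [k] or into
    the path of [tau i k], where the 12 permutations [tau i] of [K] form an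
    expander.  To allow this, each path is started from a chain containing, for
    every such [z], a private edge [xy] inside the neighbourhood of [z]
    (it exists by joinedness): [z] is inserted between [x] and [y].
    The vertices outside the chains and [Z] are covered by few paths, which are
    linked through [Z] into one path, cut into [#|K|] nearly equal parts; the
    parts are linked through [Z] to the chains and to the branch vertices.
    Links always have length 3, so only the insertions are not yet balanced.
    The links spend few vertices of each fibre, so by expansion the remaining
    vertices of [Z] can be distributed among the paths up to an error of one
    (augmenting paths).  The parts and the insertions each contribute an
    imbalance of at most one, whence lengths in a window of three values. *)

Set Implicit Arguments.
Unset Strict Implicit.
Unset Printing Implicit Defensive.

(** In the binomial expansion of [((N - 1) + 1) ^ N] the first two terms are each at least
    [(N - 1) ^ N]. *)
Lemma expn_pred_double N : 0 < N -> 2 * N.-1 ^ N <= N ^ N.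
Proof.
case: N => // N _ /=.
have -> : N.+1 ^ N.+1 = \sum_(i < N.+2) 'C(N.+1, i) * (N ^ (N.+1 - i) * 1 ^ i).
  by rewrite -expnDn addn1.
rewrite big_ord_recl big_ord_recl /= bin0 bin1 subn0 !exp1n !muln1 mul1n.
rewrite /bump /= subSS subn0 mulSn; have := expnS N N; lia.
Qed.

Lemma card_bigcup_leq (I T : finType) (P : pred I) (F : I -> {set T}) :
  #|\bigcup_(i | P i) F i| <= \sum_(i | P i) #|F i|.
Proof.
elim/big_ind2: _ => [|A a B b hA hB|//]; first by rewrite cards0.
by rewrite (leq_trans (leq_card_setU a b)) ?leq_add.
Qed.

(** * Random colourings *)

Section Coloring.
Variables (V : finType) (g k : nat).

Definition color_deg (f : V -> 'I_g) (A : {set V}) c := #|[set w in A | f w == c]|.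

(* Exponential moment method: a colouring [f] has weight
   [2 ^ (#|V| - color_deg f A c)]. *)
Lemma sum_color_weight (A : {set V}) (c : 'I_g) :
  \sum_(f : {ffun V -> 'I_g}) \prod_w (if (w \in A) && (f w == c) then 1 else 2)
  = (2 * g).-1 ^ #|A| * (2 * g) ^ (#|V| - #|A|).
Proof.
rewrite -(bigA_distr_bigA (fun w x => if (w \in A) && (x == c) then 1 else 2)) /=.
have -> : #|V| - #|A| = #|~: A| by have := cardsC A; lia.
rewrite (bigID (mem A)) /=; congr (_ * _).
  rewrite (eq_bigr (fun=> (2 * g).-1)) ?prod_nat_const //.
  move=> w wA; rewrite wA /= (bigD1 c) //= eqxx.
  rewrite (eq_bigr (fun=> 2)); last by move=> x /negPf ->.
  rewrite sum_nat_const cardC1 card_ord; have := ltn_ord c; lia.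
rewrite (eq_bigr (fun=> 2 * g)); last first.
  move=> w /negPf ->; rewrite /= sum_nat_const card_ord; lia.
by rewrite prod_nat_const; congr (_ ^ _); apply: eq_card => x; rewrite !inE.
Qed.

Lemma color_weight (f : {ffun V -> 'I_g}) (A : {set V}) (c : 'I_g) :
  \prod_w (if (w \in A) && (f w == c) then 1 else 2) = 2 ^ (#|V| - color_deg f A c).
Proof.
rewrite (bigID (mem [set w in A | f w == c])) /= big1 ?mul1n; last first.
  by move=> w; rewrite inE => ->.
rewrite (eq_bigr (fun=> 2)); last by move=> w; rewrite inE => /negPf ->.
rewrite prod_nat_const /color_deg; congr (_ ^ _); set B := [set w in A | _].
have <- : #|~: B| = #|V| - #|B| by have := cardsC B; lia.
by apply: eq_card => x; rewrite [RHS]inE.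
Qed.

(** Markov's inequality: a bad colouring weighs at least [2 ^ (#|V| - k)], while the average weight
    is at most [2 ^ #|V| / 4 ^ k], because [#|A| >= 2 * g * (2 * k)] and
    [(1 - 1 / (2 * g)) ^ (2 * g) <= 1 / 2]. *)
Lemma card_bad_color (A : {set V}) (c : 'I_g) :
  4 * g * k <= #|A| ->
  #|[set f : {ffun V -> 'I_g} | color_deg f A c < k]| * 2 ^ k <= g ^ #|V|.
Proof.
move=> hA; set bad := [set f | _].
have gpos : 0 < g by apply: leq_trans (ltn_ord c).
have AV : #|A| <= #|V| by apply: max_card.
have kV : k <= #|V| by apply: leq_trans AV; apply: leq_trans hA; rewrite leq_pmull; lia.
have h1 : #|bad| * 2 ^ (#|V| - k) <= (2 * g).-1 ^ #|A| * (2 * g) ^ (#|V| - #|A|).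
  rewrite -(sum_color_weight A c) (bigID (mem bad)) /= -sum_nat_const.
  apply: leq_trans (leq_addr _ _); apply: leq_sum => f; rewrite inE => hf.
  by rewrite color_weight leq_exp2l // leq_sub2l // ltnW.
have h2 : 4 ^ k * (2 * g).-1 ^ #|A| <= (2 * g) ^ #|A|.
  have -> : #|A| = 2 * g * (2 * k) + (#|A| - 4 * g * k) by lia.
  have hp e : (2 * g).-1 ^ e <= (2 * g) ^ e.
    by case: e => // e; rewrite leq_exp2r ?leq_pred.
  rewrite !expnD mulnA leq_mul // !(expnM _ (2 * g)) -[4]/(2 ^ 2) -expnM -expnMn.
  by case: (posnP k) => [->|kp] //; rewrite leq_exp2r ?expn_pred_double; lia.
have h3 : #|bad| * 2 ^ (#|V| - k) * 4 ^ k <= (2 * g) ^ #|V|.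
  apply: leq_trans (leq_mul h1 (leqnn (4 ^ k))) _.
  by rewrite -{2}(subnKC AV) expnD mulnAC leq_mul // mulnC.
have : #|bad| * 2 ^ k * 2 ^ #|V| <= g ^ #|V| * 2 ^ #|V|.
  rewrite -expnMn (mulnC g); apply: leq_trans h3.
  rewrite -!mulnA leq_mul2l; apply/orP; right.
  by rewrite -[4]/(2 ^ 2) -expnM -!expnD leq_exp2l //; lia.
by rewrite leq_pmul2r ?expn_gt0.
Qed.

(** Union bound over the [#|V| * g] pairs of a vertex and a colour, each failing with probability at
    most [1 / 2 ^ k]. *)
Lemma coloring_exists (N : V -> {set V}) :
    (forall v, 4 * g * k <= #|N v|) -> #|V| * g < 2 ^ k -> 0 < g ->
  exists f : V -> 'I_g, forall v c, k <= color_deg f (N v) c.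
Proof.
move=> hN hk gpos.
case: (boolP [exists f : {ffun V -> 'I_g},
   [forall v, [forall c, k <= color_deg f (N v) c]]]).
  by case/existsP=> f /forallP Hf; exists f => v c; have /forallP := Hf v; apply.
rewrite negb_exists => /forallP Hbad.
suff : g ^ #|V| * 2 ^ k <= #|V| * g * g ^ #|V|.
  by rewrite mulnC leq_pmul2r ?expn_gt0 ?gpos //; lia.
have -> : g ^ #|V| = #|[set: {ffun V -> 'I_g}]| by rewrite cardsT card_ffun card_ord.
pose bad (p : V * 'I_g) := [set f : {ffun V -> 'I_g} | color_deg f (N p.1) p.2 < k].
have hsub : [set: {ffun V -> 'I_g}] \subset \bigcup_p bad p.
  apply/subsetP => f _; have := Hbad f.
  rewrite negb_forall => /existsP [v]; rewrite negb_forall => /existsP [c].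
  by rewrite -ltnNge => h; apply/bigcupP; exists (v, c); rewrite ?inE.
apply: leq_trans (leq_mul (subset_leq_card hsub) (leqnn _)) _.
apply: leq_trans (leq_mul (card_bigcup_leq _ _) (leqnn _)) _.
have -> : #|V| * g = #|{: V * 'I_g}| by rewrite card_prod card_ord.
rewrite big_distrl /= -sum_nat_const.
by apply: leq_sum => -[v c] _; rewrite cardsT card_ffun card_ord card_bad_color.
Qed.
End Coloring.

(** * Expanding families of permutations *)

Section PermCount.
Variables (K : finType) (R : {set K}).
Implicit Types (A : {set K}) (s : {perm K}).

Definition perms_into A := [set s : {perm K} | s @: A \subset R].

(** Precomposition with the transposition of [x] and [y] is injective and carries the first set into
    the second. *)
Lemma perms_into_swap A x y : x \notin A -> y \notin A ->
  #|perms_into (x |: A)| <= #|perms_into (y |: A)|.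
Proof.
move=> xA yA; rewrite -(card_imset (mem (perms_into (x |: A))) (@mulgI _ (tperm x y))).
apply: subset_leq_card; apply/subsetP => _ /imsetP[s + ->]; rewrite !inE => /subsetP hs.
apply/subsetP => _ /imsetP[z + ->]; rewrite !inE permM => /orP[/eqP ->|zA].
  by rewrite tpermR; apply: hs; apply: imset_f; rewrite !inE eqxx.
by rewrite tpermD; [apply: hs; apply: imset_f; rewrite !inE zA orbT
  | apply: contraNneq xA => -> | apply: contraNneq yA => ->].
Qed.

(** Double counting: for a fixed [s], the admissible [x] are the preimages of the points of [R]
    outside [s @: A]. *)
Lemma sum_perms_into A :
  \sum_(x in ~: A) #|perms_into (x |: A)| = #|perms_into A| * (#|R| - #|A|).
Proof.
rewrite -sum_nat_const.
transitivity (\sum_(x in ~: A) \sum_(s in perms_into A) (s x \in R)).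
  apply: eq_bigr => x _; rewrite -sum1_card big_mkcond [RHS]big_mkcond /=.
  apply: eq_bigr => s _; rewrite !inE imsetU1 subUset sub1set.
  by rewrite andbC; case: (_ \subset _); case: (_ \in _).
rewrite exchange_big /=; apply: eq_bigr => s; rewrite inE => hs.
have -> : #|A| = #|s @: A| by rewrite card_imset //; apply: perm_inj.
have -> : #|R| - #|s @: A| = #|R :\: s @: A|.
  by rewrite cardsD (setIidPr hs).
rewrite -big_mkcondr sum1_card -(card_imset (mem (R :\: _)) (@perm_inj _ (s^-1)%g)).
apply: eq_card => x; rewrite -[LHS]/((x \in ~: A) && (s x \in R)) in_setC.
apply/andP/imsetP => [[xA xR]|[y + ->]].
  exists (s x); rewrite ?permK // !inE xR andbT.
  by apply: contra xA => /imsetP[z zA /perm_inj ->].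
rewrite !inE permKV => /andP[yA ->]; split=> //.
by apply: contra yA => h; apply/imsetP; exists ((s^-1)%g y); rewrite ?permKV.
Qed.

(** A random permutation maps [A] into [R] with probability at most [(#|R| / #|K|) ^ #|A|]. Adding a
    point to [B] costs a factor at most [(#|R| - #|B|) / (#|K| - #|B|)], which is at most
    [#|R| / #|K|]. *)
Lemma card_perms_into A :
  #|perms_into A| * #|K| ^ #|A| <= #|R| ^ #|A| * #|K|`!.
Proof.
have [a] := ubnP #|A|; elim: a A => // a IH A; rewrite ltnS => hA.
case: (set_0Vmem A) => [->|[x xA]].
  rewrite cards0 !expn0 mul1n muln1 -cardsT -card_perm.
  by apply: subset_leq_card; apply/subsetP => s _; apply/subsetP => z _; rewrite inE.
have [B xB defA] : exists2 B : {set K}, x \notin B & A = x |: B.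
  by exists (A :\ x); rewrite ?setD11 ?setD1K.
rewrite {xA}defA cardsU1 xB /= in hA *.
have {IH}IHB : #|perms_into B| * #|K| ^ #|B| <= #|R| ^ #|B| * #|K|`! by apply: IH.
have hN : (#|K| - #|B|) * #|perms_into (x |: B)| <= #|perms_into B| * (#|R| - #|B|).
  rewrite -sum_perms_into; have -> : #|K| - #|B| = #|~: B| by have := cardsC B; lia.
  rewrite -sum_nat_const; apply: leq_sum => y; rewrite inE => yB.
  exact: perms_into_swap.
have BK : #|B| < #|K|.
  by rewrite -cardsT; apply: proper_card; apply/properP; split=> //; exists x.
have RK : #|R| <= #|K| by apply: max_card.
suff h : #|perms_into (x |: B)| * #|K| <= #|R| * #|perms_into B|.
  rewrite !add1n !expnS mulnA; apply: leq_trans (leq_mul h (leqnn _)) _.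
  by rewrite -!mulnA leq_mul2l IHB orbT.
have pos : 0 < #|K| - #|B| by lia.
rewrite -(leq_pmul2l pos).
move: hN BK RK {pos}; move: #|perms_into _| #|perms_into _| #|K| #|B| #|R| => N' N k b r.
move=> h1 h2 h3; have h : (r - b) * k <= (k - b) * r.
  rewrite !mulnBl; case: (leqP r b) => hrb; nia.
apply: (@leq_trans (N' * (r - b) * k)); first by rewrite mulnA leq_mul2r h1 orbT.
by rewrite [r * N']mulnC mulnCA -mulnA leq_mul2l h orbT.
Qed.
End PermCount.

(** * Binomial and geometric estimates *)

Lemma leq_expl e m n : m <= n -> m ^ e <= n ^ e.
Proof. by case: e => // e; rewrite leq_exp2r. Qed.

Lemma leq_bin_expn2 n k : 'C(n, k) <= 2 ^ n.
Proof.
have -> : 2 ^ n = #|powerset [set: 'I_n]| by rewrite card_powerset cardsT card_ord.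
rewrite -{1}(card_ord n) -card_draws; apply: subset_leq_card.
by apply/subsetP => A _; rewrite inE subsetT.
Qed.

(** Division-free form of ['C(m, s) <= (4 * m / s) ^ s]; the lower bound on the factorial comes from
    [s ^ s <= 'C(2 * s, s) * s! <= 4 ^ s * s!]. *)
Lemma bin_expn_bound m s : 'C(m, s) * s ^ s <= 4 ^ s * m ^ s.
Proof.
have h1 : 'C(m, s) * s`! <= m ^ s.
  rewrite bin_ffact ffact_prod -[in leqRHS](card_ord s) -prod_nat_const.
  by apply: leq_prod => i _; apply: leq_subr.
have h2 : s ^ s <= 'C(s.*2, s) * s`!.
  rewrite bin_ffact ffact_prod -[in leqLHS](card_ord s) -prod_nat_const.
  by apply: leq_prod => i _; rewrite card_ord; have := ltn_ord i; lia.
have h3 : 'C(s.*2, s) <= 4 ^ s.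
  by rewrite -[4]/(2 ^ 2) -expnM mul2n leq_bin_expn2.
have : 'C(m, s) * s ^ s * s`! <= 4 ^ s * m ^ s * s`!.
  rewrite mulnAC mulnC [4 ^ s * _]mulnC -[leqRHS]mulnA mulnC.
  by apply: leq_mul => //; apply: leq_trans h2 _; rewrite leq_mul2r h3 orbT.
by rewrite leq_pmul2r ?fact_gt0.
Qed.

(** The powers of [1 / 4] sum to [1 / 3]; the induction carries the exact partial sums. *)
Lemma geometric_sum_lt (S : nat -> nat) F m : 0 < F ->
  (forall r, r <= m -> S r * 4 ^ r <= F) -> \sum_(1 <= r < m.+1) S r < F.
Proof.
move=> F0 hS.
suff h j : j <= m -> 3 * 4 ^ j * (\sum_(1 <= r < j.+1) S r) <= F * (4 ^ j - 1).
  have := h m (leqnn m); have : 0 < 4 ^ m by rewrite expn_gt0.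
  by move: (4 ^ m) (\sum_(_ <= _ < _) _) => x y; nia.
elim: j => [|j IH] jm; first by rewrite big_geq.
rewrite big_nat_recr //= mulnDr.
have := IH (ltnW jm); have := hS _ jm; rewrite expnS; have : 0 < 4 ^ j by rewrite expn_gt0.
by move: (4 ^ j) (\sum_(_ <= _ < _) _) (S j.+1) => x y z; nia.
Qed.

(** * Existence of the expanding family *)

Section Expander.
Variable K : finType.
Let m := #|K|.

Definition closed_part (R : {set K}) (tau : 'I_12 -> {perm K}) :=
  [set k in R | [forall i, tau i k \in R]].

Let into (p : {set K} * {set K}) :=
  [set tau : {ffun 'I_12 -> {perm K}} | [forall i, tau i \in perms_into p.1 p.2]].

(** Possible witnesses of a failure: a set and a part of it just above half. Fixing the size of the
    part fixes the exponent given by [card_perms_into]. *)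
Let P (p : {set K} * {set K}) :=
  [&& p.1 != set0, 2 * #|p.1| <= m, p.2 \subset p.1 & #|p.2| == #|p.1|./2.+1].

Lemma card_into p : #|into p| = #|perms_into p.1 p.2| ^ 12.
Proof.
transitivity (#|perms_into p.1 p.2| ^ #|'I_12|); last by rewrite card_ord.
rewrite -card_ffun_on; apply: eq_card => tau; rewrite inE.
by apply/forallP/ffun_onP.
Qed.

Lemma card_into_bound p : P p ->
  #|into p| * ('C(m, #|p.1|) * 8 ^ #|p.1|) <= m`! ^ 12.
Proof.
case: p => R A /and4P[/= R0 Rm AR /eqP hA]; rewrite card_into /=.
have := card_perms_into R A; rewrite hA -/m; set a := _.+1; set r := #|R| in Rm a *.
set N := #|_| => hN.
have m0 : 0 < m by move: Rm; rewrite -card_gt0 -/r in R0; lia.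
have ra : 6 * r <= 12 * a by rewrite /a; lia.
have key : 'C(m, r) * 8 ^ r * r ^ (12 * a) <= m ^ (12 * a).
  (* Since [2 * a >= r], at least [6 * r] factors [r / m] are available: [r] of them reduce the
     binomial coefficient to [4 ^ r], and [5 * r] more, each at most [1 / 2], pay for
     [4 ^ r * 8 ^ r = 32 ^ r]. *)
  have -> : 12 * a = r + 5 * r + (12 * a - 6 * r) by lia.
  rewrite !(expnD _ (r + 5 * r)) expnD !mulnA.
  apply: leq_mul; last by apply: leq_expl; lia.
  have -> : 'C(m, r) * 8 ^ r * r ^ r * r ^ (5 * r) =
            ('C(m, r) * r ^ r) * (8 ^ r * r ^ (5 * r)) by lia.
  apply: leq_trans (leq_mul (bin_expn_bound m r) (leqnn _)) _.
  have -> : 4 ^ r * m ^ r * (8 ^ r * r ^ (5 * r)) = m ^ r * (32 ^ r * r ^ (5 * r)).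
    by rewrite -[32]/(4 * 8) expnMn; lia.
  by rewrite expnD leq_mul2l -[32]/(2 ^ 5) -expnM -expnMn leq_expl ?orbT.
have hN12 : N ^ 12 * m ^ (12 * a) <= r ^ (12 * a) * m`! ^ 12.
  by have := leq_expl 12 hN; rewrite !expnMn -!expnM ![a * 12]mulnC.
rewrite -(@leq_pmul2r (m ^ (12 * a))) ?expn_gt0 ?m0 //.
rewrite mulnAC; apply: leq_trans (leq_mul hN12 (leqnn _)) _.
by rewrite mulnAC [leqRHS]mulnC leq_mul2r [_ * (_ * _)]mulnC key orbT.
Qed.

Lemma card_P r : #|[set p | P p & #|p.1| == r]| <= 'C(m, r) * 2 ^ r.
Proof.
rewrite -sum1_card -card_draws -sum_nat_const.
apply: (@leq_trans (\sum_(R in [set R : {set K} | #|R| == r]) \sum_(A in powerset R) 1)).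
  rewrite pair_big_dep /= !sum1_card; apply: subset_leq_card; apply/subsetP => -[R A].
  by rewrite !inE /= => /andP[/and4P[_ _ AR _] hr]; rewrite unfold_in /= powersetE inE hr.
by apply: leq_sum => R; rewrite inE => /eqP <-; rewrite sum1_card card_powerset.
Qed.

(** The [2 ^ r] choices of a part use up only a third of the exponent in [8 ^ r]; the remaining
    [4 ^ r] makes the bounds summable over [r]. *)
Lemma sum_into r : r <= m ->
  (\sum_(p | P p && (#|p.1| == r)) #|into p|) * 4 ^ r <= m`! ^ 12.
Proof.
move=> rm.
have C0 : 0 < 'C(m, r) * 2 ^ r by rewrite muln_gt0 bin_gt0 rm expn_gt0.
rewrite -(leq_pmul2l C0) mulnCA.
have -> : 'C(m, r) * 2 ^ r * 4 ^ r = 'C(m, r) * 8 ^ r.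
  by rewrite -mulnA -expnMn.
rewrite big_distrl /=; apply: (@leq_trans (\sum_(p in [set p | P p & #|p.1| == r]) m`! ^ 12)).
  rewrite [leqRHS](eq_bigl (fun p => P p && (#|p.1| == r))); last by move=> p; rewrite inE.
  by apply: leq_sum => p /andP[Pp /eqP <-]; apply: card_into_bound.
by rewrite sum_nat_const leq_mul ?card_P.
Qed.

(* If [R] does not expand, half of it is mapped into [R] by all 12 permutations:
   union bound over [R] and that half. *)
Lemma expander_exists : exists tau : 'I_12 -> {perm K}, forall R : {set K},
  2 * #|R| <= m -> 2 * #|closed_part R tau| <= #|R|.
Proof.
case: (boolP [exists tau : {ffun 'I_12 -> {perm K}}, [forall R : {set K},
  (2 * #|R| <= m) ==> (2 * #|closed_part R tau| <= #|R|)]]).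
  by case/existsP=> tau /forallP h; exists tau => R; apply/implyP.
rewrite negb_exists => /forallP Hbad.
have F0 : 0 < m`! ^ 12 by rewrite expn_gt0 fact_gt0.
have := geometric_sum_lt F0 sum_into.
suff : m`! ^ 12 <= \sum_(1 <= r < m.+1) \sum_(p | P p && (#|p.1| == r)) #|into p|.
  by lia.
have -> : m`! ^ 12 = #|[set: {ffun 'I_12 -> {perm K}}]|.
  rewrite cardsT card_ffun card_ord; congr (_ ^ _).
  by rewrite /m -cardsT -card_perm; apply: eq_card => s; apply/subsetP => z _; rewrite inE.
apply: (@leq_trans (\sum_(p | P p) #|into p|)).
  apply: leq_trans (card_bigcup_leq _ _); apply: subset_leq_card; apply/subsetP => tau _.
  have := Hbad tau; rewrite negb_forall => /existsP[R]; rewrite negb_imply -ltnNge.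
  move=> /andP[Rm hR].
  have /card_geqP[s [us ss sub]] : #|R|./2.+1 <= #|closed_part R tau|.
    by rewrite ltn_half_double -mul2n.
  apply/bigcupP; exists (R, [set x in s]).
    apply/and4P; split => //=; rewrite -?ss.
    - apply: contraTneq hR => ->; rewrite -leqNgt cards0 leqn0 muln_eq0 cards_eq0 /=.
      by apply/eqP/setP => x; rewrite !inE.
    - by apply/subsetP => x; rewrite inE => /sub; rewrite inE => /andP[].
    - by rewrite cardsE; apply/eqP/card_uniqP.
  rewrite inE; apply/forallP => i; rewrite inE; apply/subsetP => _ /imsetP[x + ->] /=.
  by rewrite inE => /sub; rewrite inE => /andP[_ /forallP].
rewrite (exchange_big_dep P) /=; last by move=> r p _ /andP[].
apply: leq_sum => p Pp; rewrite Pp big_mkcond (bigD1_seq #|p.1|) ?iota_uniq ?eqxx ?leq_addr //=.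
case/and4P: Pp => p0 pm _ _; rewrite mem_index_iota card_gt0 p0 /=; lia.
Qed.
End Expander.

(** * Balanced distribution of the reserve *)

(* [(k, r)] is the [r]-th reserve vertex of the fibre of [k]; it is spent if [hit],
   and is otherwise inserted into the path [dest f (k, r)]. *)
Section Tokens.
Variables (K : finType) (tau : 'I_12 -> {perm K}) (q h : nat).
Variable hit : pred (K * 'I_q).

(** [None] keeps a vertex with the path of its own fibre, so each vertex has 13 possible
    insertions. *)
Definition option_perm (o : option 'I_12) : {perm K} := oapp tau 1%g o.

Implicit Types (f : {ffun K * 'I_q -> option 'I_12}) (z : K * 'I_q) (k : K).

Definition dest f z := option_perm (f z) z.1.
Definition load f k := #|[set z | ~~ hit z & dest f z == k]|.

(** Residual digraph for augmenting paths: some unspent vertex now inserted into [k] could be moved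
    to [k']. *)
Let arc f k k' := [exists z, [&& ~~ hit z, dest f z == k &
  [exists o, option_perm o z.1 == k']]].

Let reassign f z o := [ffun z' => if z' == z then o else f z'] :
  {ffun K * 'I_q -> option 'I_12}.

Lemma load_reassign f z o j : ~~ hit z ->
  load (reassign f z o) j + (j == dest f z) = load f j + (j == option_perm o z.1).
Proof.
move=> hz; rewrite /load (cardsD1 z) [in RHS](cardsD1 z) !inE hz /=.
have -> : dest (reassign f z o) z = option_perm o z.1 by rewrite /dest ffunE eqxx.
set A := _ :\ z; set B := [set _ | ~~ hit _ & dest f _ == j] :\ z.
have -> : A = B.
  by apply/setP => y; rewrite !inE /dest ffunE; case: eqP.
by rewrite ![_ == j]eq_sym; lia.
Qed.

Lemma augment f k p : path (arc f) k p -> uniq (k :: p) ->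
  exists f', forall j, load f' j + (j == k) = load f j + (j == last k p).
Proof.
elim: p k f => [|k2 p IH] k f; first by exists f.
rewrite [path _ _ _]/= => /andP[/existsP[z /and3P[hz /eqP dz /existsP[o /eqP ho]]] hp].
rewrite cons_uniq => /andP[kp up].
(* Reassigning [z] can only destroy arcs leaving [k], and the rest of the simple path avoids [k]. *)
have hp' : path (arc (reassign f z o)) k2 p.
  apply: (@sub_in_path _ (predC1 k)) hp; last first.
    by apply/allP => x xp; rewrite inE; apply: contraNneq kp => <-.
  move=> x y; rewrite !inE => xk _ /existsP[z' /and3P[hz' /eqP dz' h']].
  apply/existsP; exists z'; rewrite hz' h' andbT /= /dest ffunE; case: (z' =P z) => [zz|_].
    by rewrite -dz' zz dz eqxx in xk.
  exact/eqP.
have [f' hf'] := IH _ _ hp' up; exists f' => j.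
have := load_reassign f o j hz; rewrite dz ho; have := hf' j.
rewrite [last k _]/=; lia.
Qed.

Let potential f := \sum_k load f k ^ 2.

Lemma potential_decr f f' a b : a != b -> load f b + 2 <= load f a ->
  (forall j, load f' j + (j == a) = load f j + (j == b)) -> potential f' < potential f.
Proof.
move=> ab lab hf; have e : \sum_(j | (j != a) && (j != b)) load f' j ^ 2 =
         \sum_(j | (j != a) && (j != b)) load f j ^ 2.
  apply: eq_bigr => j /andP[ja jb].
  by have := hf j; rewrite (negPf ja) (negPf jb) !addn0 => ->.
have split_ab F : \sum_j F j =
    F a + (F b + \sum_(j | (j != a) && (j != b)) F j) :> nat.
  by rewrite (bigD1 a) //= (bigD1 b) 1?eq_sym.
rewrite /potential !split_ab e.
have := hf a; have := hf b; rewrite !eqxx (negPf ab) eq_sym (negPf ab) !addn0.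
rewrite !expnS; nia.
Qed.

Lemma sum_load f (R : {set K}) :
  \sum_(k in R) load f k = #|[set z | ~~ hit z & dest f z \in R]|.
Proof.
rewrite -sum1_card (partition_big (dest f) (mem R)) /=; last by move=> z; rewrite inE => /andP[].
apply: eq_bigr => k kR; rewrite /load -sum1_card; apply: eq_bigl => z.
by rewrite !inE; case: (dest f z =P k) => [->|_]; rewrite ?kR ?andbT ?andbF.
Qed.

Hypothesis expander : forall R : {set K},
  2 * #|R| <= #|K| -> 2 * #|closed_part R tau| <= #|R|.
Hypothesis few_hits : forall k, #|[set r | hit (k, r)]| <= h.
Hypothesis h_small : 25 * h < q.

Lemma card_tokens (J : {set K}) : #|[set z : K * 'I_q | z.1 \in J]| = #|J| * q.
Proof.
rewrite -[in RHS](card_ord q) -[in RHS]cardsT -cardsX.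
by apply: eq_card => z; rewrite !inE andbT.
Qed.

Lemma card_unhit (J : {set K}) :
  #|J| * (q - h) <= #|[set z : K * 'I_q | ~~ hit z & z.1 \in J]|.
Proof.
rewrite -[leqRHS]sum1_card (partition_big fst (mem J)) /=; last by move=> z; rewrite inE => /andP[].
rewrite -sum_nat_const; apply: leq_sum => k kJ.
apply: (@leq_trans #|[set r | ~~ hit (k, r)]|).
  have := cardsC [set r | hit (k, r)]; rewrite card_ord => hC; have := few_hits k.
  have e : ~: [set r | hit (k, r)] = [set r | ~~ hit (k, r)] by apply/setP => r; rewrite !inE.
  rewrite e in hC; lia.
have pair_inj : injective (fun r : 'I_q => (k, r)) by move=> r r' [].
rewrite -(card_imset _ pair_inj) sum1_card; apply: subset_leq_card.
by apply/subsetP => _ /imsetP[r + ->]; rewrite !inE unfold_in /= inE kJ eqxx andbT => ->.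
Qed.

(** A permutation moves as many points into [Q] as out of it. At least half of [Q] is moved out by
    one of the 12 permutations, and each of them moves out at most as many points as the boundary
    has; hence [24 = 2 * 12]. *)
Lemma boundary_into (Q : {set K}) : 2 * #|Q| <= #|K| ->
  #|Q| <= 24 * #|[set k in ~: Q | [exists o, option_perm o k \in Q]]|.
Proof.
move=> hQ; set J := [set k in _ | _].
have hi i : #|[set k in Q | tau i k \notin Q]| <= #|J|.
  have -> : #|[set k in Q | tau i k \notin Q]| = #|[set k in ~: Q | tau i k \in Q]|.
    have e1 : #|[set k in Q | tau i k \in Q]| + #|[set k in Q | tau i k \notin Q]| = #|Q|.
      rewrite -(cardsID [set k | tau i k \in Q] Q); congr (_ + _).
        by apply: eq_card => k; rewrite !inE.
      by apply: eq_card => k; rewrite !inE andbC.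
    have e2 : #|[set k in Q | tau i k \in Q]| + #|[set k in ~: Q | tau i k \in Q]| = #|Q|.
      rewrite -(card_imset (mem Q) (@perm_inj _ (tau i)^-1%g)).
      rewrite -(cardsID Q (_ @: _)) /=; congr (_ + _); apply: eq_card => k; rewrite !inE.
        rewrite andbC; congr (_ && _).
        apply/idP/imsetP => [kQ|[x xQ ->]]; last by rewrite permKV.
        by exists (tau i k); rewrite ?permK.
      congr (_ && _).
      apply/idP/imsetP => [kQ|[x xQ ->]]; last by rewrite permKV.
      by exists (tau i k); rewrite ?permK.
    lia.
  apply: subset_leq_card; apply/subsetP => k; rewrite !inE => /andP[-> h'].
  by apply/existsP; exists (Some i).
have h1 : #|Q :\: closed_part Q tau| <= 12 * #|J|.
  apply: (@leq_trans (\sum_(i < 12) #|[set k in Q | tau i k \notin Q]|)); last first.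
    apply: (@leq_trans (\sum_(i < 12) #|J|)); first exact: leq_sum.
    by rewrite sum_nat_const card_ord.
  apply: leq_trans (card_bigcup_leq _ _); apply: subset_leq_card.
  apply/subsetP => k; rewrite !inE negb_and => /andP[/orP[/negP//|] + kQ].
  by rewrite negb_forall => /existsP[i hi']; apply/bigcupP; exists i; rewrite ?inE ?kQ.
have := expander hQ; have : closed_part Q tau \subset Q.
  by apply/subsetP => k; rewrite inE => /andP[].
move=> /setIidPr sub; have := cardsID (closed_part Q tau) Q; rewrite sub; lia.
Qed.

(* Take [f] minimizing the sum of squared loads.  If it is not balanced, the set [R]
   reachable from the paths of load at least [l0 + 2] ([l0] the minimal load)
   avoids load [l0] and keeps all the vertices it can get, and expansion of the
   smaller of [R] and its complement contradicts the count of available vertices. *)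
Lemma balanced_exists : exists f, forall k k', load f k <= load f k' + 1.
Proof.
pose f0 : {ffun K * 'I_q -> option 'I_12} := [ffun=> None].
case: (@arg_minnP _ f0 xpredT potential isT) => f _ fmin; exists f => k1 k2.
rewrite leqNgt; apply/negP => hk.
case: (@arg_minnP _ k2 xpredT (load f) isT) => k0 _ lmin; set l0 := load f k0 in lmin.
have hk1 : l0 + 2 <= load f k1 by have := lmin k2 isT; lia.
pose R := [set k | [exists a, (l0 + 2 <= load f a) && connect (arc f) a k]].
have Rgt k : k \in R -> l0 + 1 <= load f k.
  rewrite inE => /existsP[a /andP[la /connectP[p hp dk]]].
  have := lmin k isT; rewrite leq_eqVlt => /orP[/eqP lk|]; last by lia.
  (* A simple path from load at least [l0 + 2] to load [l0] could be augmented, contradicting the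
     minimal potential. *)
  case/shortenP: hp dk => p' hp' up' _ dk.
  have [f' hf'] := augment hp' up'; rewrite -dk in hf'.
  have ak : a != k by apply: contraTneq la => ->; lia.
  have := potential_decr ak _ hf'; rewrite -lk => /(_ la).
  by rewrite ltnNge fmin.
have Rle k : k \notin R -> load f k <= l0 + 1.
  move=> kR; rewrite leqNgt; apply: contra kR => lk; rewrite inE; apply/existsP.
  by exists k; rewrite connect0 andbT; lia.
have Rcl z o : ~~ hit z -> dest f z \in R -> option_perm o z.1 \in R.
  move=> hz; rewrite !inE => /existsP[a /andP[la ca]]; apply/existsP; exists a; rewrite la.
  apply: connect_trans ca (connect1 _); apply/existsP; exists z; rewrite hz eqxx /=.
  by apply/existsP; exists o.
have k1R : k1 \in R by rewrite inE; apply/existsP; exists k1; rewrite hk1 connect0.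
have k0R : k0 \notin R by apply/negP => /Rgt; rewrite -/l0; lia.
clearbody R.
have sum_all : \sum_(k in R) load f k + \sum_(k in ~: R) load f k =
               #|[set z : K * 'I_q | ~~ hit z & z.1 \in [set: K]]|.
  rewrite !sum_load -[RHS](cardsID [set z | dest f z \in R]); congr (_ + _).
    by apply: eq_card => z; rewrite !inE andbT.
  by apply: eq_card => z; rewrite !inE andbT andbC.
have totle : #|[set z : K * 'I_q | ~~ hit z & z.1 \in [set: K]]| <= #|K| * q.
  rewrite -cardsT -card_tokens; apply: subset_leq_card.
  by apply/subsetP => z; rewrite !inE andbT.
have totge := card_unhit [set: K]; rewrite cardsT in totge.
have cR := cardsC R.
have sumQ : \sum_(k in ~: R) load f k <= #|~: R| * (l0 + 1).
  by rewrite -sum_nat_const; apply: leq_sum => k; rewrite inE; apply: Rle.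
have sumR : #|R| * (l0 + 1) <= \sum_(k in R) load f k.
  by rewrite -sum_nat_const; apply: leq_sum => k; apply: Rgt.
have R0 : 0 < #|R| by rewrite card_gt0; apply/set0Pn; exists k1.
(* If [R] is small, every vertex inserted into [R] comes from a fibre in the closed part, so the
   mean load on [R] is at most [q / 2]. Then [l0 + 1 <= q / 2], and the total load is too small for
   so few hits. *)
case: (leqP (2 * #|R|) #|K|) => hR.
  have hin : \sum_(k in R) load f k <= #|closed_part R tau| * q.
    rewrite sum_load -card_tokens; apply: subset_leq_card; apply/subsetP => z.
    rewrite !inE => /andP[hz dz]; have cl o := Rcl z o hz dz.
    have := cl None; rewrite /option_perm /= perm1 => -> /=.
    by apply/forallP => i; apply: (cl (Some i)).
  have := expander hR; move: sum_all totle totge hin sumR sumQ cR R0.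
  move: (\sum_(_ in _) _) (\sum_(_ in _) _) #|[set _ | _]| #|closed_part _ _| #|R| #|~: R| => S1 S2 tot c r r' *.
  have : 2 * (l0 + 1) <= q by nia.
  nia.
set Q := ~: R in sumQ cR sum_all *.
have hQ : 2 * #|Q| <= #|K| by lia.
have hb := boundary_into hQ; set J := [set k in _ | _] in hb.
have Q0 : 0 < #|Q| by rewrite card_gt0; apply/set0Pn; exists k0; rewrite inE.
(* Unspent vertices of the fibres in [Q] and in its boundary cannot be inserted into [R], which is
   closed under reassignment. With [#|Q| <= 24 * #|J|] this forces [25 * (q - h) <= 24 * q], against
   [25 * h < q]. *)
have hin : (#|Q| + #|J|) * (q - h) <= \sum_(k in Q) load f k.
  have <- : #|Q :|: J| = #|Q| + #|J|.
    rewrite cardsU (_ : Q :&: J = set0) ?cards0 ?subn0 //.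
    by apply/setP => x; rewrite !inE; case: (x \in R).
  apply: leq_trans (card_unhit _) _; rewrite sum_load; apply: subset_leq_card.
  apply/subsetP => z; rewrite 2!inE => /andP[hz zJ]; rewrite !inE hz /=.
  apply/negP => dz; have cl o := Rcl z o hz dz.
  have := cl None; rewrite /option_perm /= perm1 => zR.
  by move: zJ; rewrite !inE zR /= => /existsP[o]; rewrite inE cl.
have lq : l0 < q.
  rewrite ltnNge; apply/negP => ql.
  have : #|Q| * l0 <= \sum_(k in Q) load f k.
    by rewrite -sum_nat_const; apply: leq_sum => k _; apply: lmin.
  move: sum_all totle sumR cR R0.
  move: (\sum_(_ in _) _) (\sum_(_ in _) _) #|[set _ | _]| #|R| #|Q| => S1 S2 tot r r' *; nia.
move: hin sumQ hb Q0 lq h_small.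
move: (\sum_(_ in _) _) #|Q| #|J| => S c j *.
have : (c + j) * (q - h) <= c * q by nia.
nia.
Qed.
End Tokens.

(** * Greedy embedding in joined graphs *)

Section GreedyPairs.
Variables (V I : finType) (v0 : V) (link : I -> V -> V -> Prop).
Variables (ok : {set V} -> Prop) (D0 : {set V}).

Definition pairs_support (phi : I -> V * V) :=
  [set v | [exists i, (v == (phi i).1) || (v == (phi i).2)]].

(** The pairs are chosen one by one along an enumeration of [I], with [ok] as invariant. Their
    disjointness is recorded only by the cardinality of the union, as the final count requires. *)
Lemma greedy_pairs :
    ok D0 ->
    (forall i (D : {set V}), ok D -> D0 \subset D -> #|D| + 2 <= #|D0| + 2 * #|I| ->
       exists a b, [/\ a \notin D, b \notin D, a != b, link i a b & ok (a |: (b |: D))]) ->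
  exists phi : I -> V * V,
    [/\ forall i, link i (phi i).1 (phi i).2, ok (D0 :|: pairs_support phi) &
        #|D0 :|: pairs_support phi| = #|D0| + 2 * #|I|].
Proof.
move=> ok0 ext.
pose supp (s : seq I) (phi : I -> V * V) :=
  D0 :|: [set v | has (fun i => (v == (phi i).1) || (v == (phi i).2)) s].
suff h (s : seq I) : uniq s -> exists phi : I -> V * V,
    [/\ forall i, i \in s -> link i (phi i).1 (phi i).2, ok (supp s phi) &
        #|supp s phi| = #|D0| + 2 * size s].
  have [phi [h1 h2 h3]] := h (enum I) (enum_uniq I); exists phi.
  have e : supp (enum I) phi = D0 :|: pairs_support phi.
    apply/setP => v; rewrite !inE; congr (_ || _); apply/hasP/existsP.
      by case=> i _ hi; exists i.
    by case=> i hi; exists i; rewrite ?mem_enum.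
  rewrite -e h3 [#|I|]cardE; split=> // i; apply: h1; exact: mem_enum.
elim: s => [|i s IH] /=.
  move=> _; exists (fun=> (v0, v0)); rewrite /supp.
  have -> : [set v | has (fun i : I => (v == v0) || (v == v0)) [::]] = set0.
    by apply/setP => v; rewrite !inE.
  by rewrite setU0 addn0.
move=> /andP[iS /[dup] us /IH [phi [h1 h2 h3]]].
have sI : (size s).+1 <= #|I|.
  rewrite -/(size (i :: s)) -(card_uniqP _) ?max_card //= iS us //.
have [||a [b [aD bD ab lab okD]]] := ext i _ h2; first by rewrite subsetUl.
  by rewrite h3; lia.
pose phi' j := if j == i then (a, b) else phi j; exists phi'.
have e : supp (i :: s) phi' = a |: (b |: supp s phi).
  apply/setP => v; rewrite !inE /= /phi' eqxx /=.
  rewrite (@eq_in_has _ _ (fun j => (v == (phi j).1) || (v == (phi j).2)) s); last first.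
    by move=> j js; case: (j =P i) => // ji; rewrite -ji js in iS.
  by do !case: (_ == _); rewrite ?orbT.
split.
- move=> j; rewrite inE /phi'; case: (j =P i) => [-> _ //|_ /=]; exact: h1.
- by rewrite e.
- by rewrite e !cardsU1 h3 in_setU1 (negPf ab) (negPf bD) (negPf aD) /=; lia.
Qed.
End GreedyPairs.

Section JoinedGraph.
Variables (V : finType) (G : sgraph V) (m0 : nat).
Hypothesis Gjoined : joined m0 G.

(** The sets may overlap: after [m0] vertices of [A] are chosen, the factor 2 leaves [m0] others in
    [B]. *)
Lemma edge_between (A B : {set V}) : m0 <= #|A| -> 2 * m0 <= #|B| ->
  exists x y, [/\ x \in A, y \in B & G x y].
Proof.
move=> hA hB; have subset_card (X : {set V}) : m0 <= #|X| ->
    exists2 Y : {set V}, Y \subset X & #|Y| = m0.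
  case/card_geqP=> s [us ss sub]; exists [set x in s].
    by apply/subsetP => x; rewrite inE; apply: sub.
  by rewrite cardsE -ss; apply/card_uniqP.
have [A' sA cA] := subset_card A hA.
have [|B' sB cB] := subset_card (B :\: A').
  by have := cardsID A' B; have := subset_leq_card (subsetIr B A'); lia.
have [|x [y [xA yB xy]]] := Gjoined _ cA cB.
  rewrite disjoint_sym disjoints_subset; apply: subset_trans sB _.
  by apply/subsetP => x; rewrite !inE => /andP[].
exists x, y; split=> //; first exact: (subsetP sA).
by have := subsetP sB _ yB; rewrite inE => /andP[].
Qed.

Lemma edgeN x y : G x y -> x != y.
Proof. by apply: contraTneq => ->; rewrite adj_irr. Qed.

Lemma uniq_map_choice (T : eqType) (c : seq T -> T) (ps : seq (seq T)) :
  {in ps, forall p, c p \in p} -> uniq (flatten ps) -> uniq (map c ps).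
Proof.
elim: ps => //= p ps IH hc; rewrite cat_uniq => /and3P[up hn uf].
rewrite IH // ?andbT; last by move=> x xp; apply: hc; rewrite inE xp orbT.
apply: contra hn => /mapP[p' hp' e]; apply/hasP; exists (c p); last first.
  by apply: hc; rewrite mem_head.
by apply/flattenP; exists p'; rewrite // e hc // inE hp' orbT.
Qed.

(* Merge two paths as long as there are at least [3 m0] of them: some edge joins
   the last vertex of one of the first [m0] to the first vertex of another. *)
Lemma path_cover (W : {set V}) : exists ps : seq (seq V),
  [/\ forall p, p \in ps -> p != [::] /\ sorted G p,
      perm_eq (flatten ps) (enum W) & size ps <= 3 * m0].
Proof.
suff h n ps : size ps <= n -> (forall p, p \in ps -> p != [::] /\ sorted G p) ->
    perm_eq (flatten ps) (enum W) -> exists ps : seq (seq V),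
  [/\ forall p, p \in ps -> p != [::] /\ sorted G p,
      perm_eq (flatten ps) (enum W) & size ps <= 3 * m0].
  apply: (h _ [seq [:: x] | x <- enum W] (leqnn _)); last by rewrite flatten_seq1.
  by move=> p /mapP[x _ ->].
elim: n ps => [|n IH] ps hn hps pW; first by exists ps; split=> //; apply: leq_trans hn _.
case: (leqP (size ps) (3 * m0)) => hsz; first by exists ps.
case: (set_0Vmem W) => [W0|[v0 _]].
  exists [::]; split=> //=; by rewrite W0 enum_set0.
have uf : uniq (flatten ps) by rewrite (perm_uniq pW) enum_uniq.
have hd_in : {in ps, forall p, head v0 p \in p}.
  by move=> p /hps[]; case: p => //= x p _ _; rewrite mem_head.
have last_in : {in ps, forall p, last v0 p \in p}.
  by move=> p /hps[]; case: p => //= x p _ _; rewrite mem_last.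
have ul := uniq_map_choice last_in uf; have uh := uniq_map_choice hd_in uf.
have [N hN] : exists N, size ps = N by exists (size ps).
rewrite hN in hsz hn.
(* More than [3 * m0] paths give [m0] last vertices, and at least [2 * m0] first vertices among the
   other paths. *)
have [||x [y [xA yB xy]]] :=
    @edge_between [set x in map (last v0) (take m0 ps)] [set x in map (head v0) (drop m0 ps)].
- rewrite cardsE (card_uniqP _) ?map_take ?take_uniq // size_takel // size_map hN; lia.
- rewrite cardsE (card_uniqP _) ?map_drop ?drop_uniq // size_drop size_map hN; lia.
move: xA yB; rewrite !inE => /mapP[p pt ex] /mapP[p' pd ey].
pose rest := rem p (take m0 ps) ++ rem p' (drop m0 ps).
have pps : perm_eq ps (p :: p' :: rest).
  apply/seq.permP => a; rewrite -{1}(cat_take_drop m0 ps) count_cat /= count_cat.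
  rewrite (seq.permP (perm_to_rem pt)) (seq.permP (perm_to_rem pd)) /=; lia.
apply: (IH ((p ++ p') :: rest)).
- by have := perm_size pps; rewrite hN /= => e; rewrite e in hn.
- have hp z : z \in p :: p' :: rest -> z != [::] /\ sorted G z.
    by rewrite -(perm_mem pps); apply: hps.
  move=> z; rewrite inE => /orP[/eqP ->|zr]; last by apply: hp; rewrite !inE zr !orbT.
  have [] := hp p (mem_head _ _); have [] := hp p'; first by rewrite !inE eqxx orbT.
  case: p {pt pps rest hp} ex => // u p ex; case: p' {pd} ey => // w p' ey _ sp' _ sp /=.
  by split=> //; rewrite cat_path; move: sp sp' xy; rewrite ex ey /= => -> -> ->.
have -> : flatten ((p ++ p') :: rest) = flatten (p :: p' :: rest) by rewrite /= catA.
by apply: perm_trans pW; apply: perm_flatten; rewrite perm_sym.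
Qed.

(* [ok] is a growing record of the vertices spent on the connecting paths. *)
Lemma join_pieces (ok : {set V} -> Prop) (bound : nat) (ps : seq (seq V)) :
    ok set0 ->
    (forall u w (D : {set V}), ok D -> #|D| + 2 <= bound ->
       exists a b, [/\ a \notin D, b \notin D, a != b,
         path G u [:: a; b; w] & ok (a |: (b |: D))]) ->
    (forall p, p \in ps -> p != [::] /\ sorted G p) -> 2 * size ps <= bound ->
  exists (Q : seq V) (D : {set V}),
    [/\ sorted G Q, ok D, #|D| <= 2 * size ps, size Q = size (flatten ps) + #|D| &
        {subset flatten ps <= Q} /\ {subset D <= Q}].
Proof.
move=> ok0 link; elim: ps => [|p ps IH] hps hb.
  by exists [::], set0; rewrite cards0; split=> //; split=> // x; rewrite inE.
have [||Q [D [sQ okD cD szQ [subQ subD]]]] := IH; first by move=> x xp; apply: hps; rewrite inE xp orbT.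
  by move: hb => /=; lia.
have [] := hps p (mem_head _ _); case: p {hps} hb => // u p hb _ sp.
case: Q sQ szQ subQ subD => [|w Q] sQ szQ subQ subD.
  exists (u :: p), D; split=> //; first by rewrite (leq_trans cD) //= leq_mul2l leqnSn orbT.
    by move: szQ; rewrite /= size_cat /=; lia.
  split; last by move=> x /subD.
  by move=> x; rewrite mem_cat => /orP[//|/subQ].
have [|a [b [aD bD ab hl okD']]] := link (last u p) w D okD.
  by move: hb => /=; lia.
exists (u :: p ++ [:: a, b, w & Q]), (a |: (b |: D)); split=> //.
- move: hl sp sQ => /= /and4P[h1 h2 h3 _] sp sQ.
  by rewrite cat_path sp /= h1 h2 h3.
- by rewrite !cardsU1 !inE (negPf ab) (negPf aD) (negPf bD) /=; lia.
- rewrite !cardsU1 !inE (negPf ab) (negPf aD) (negPf bD) /= !size_cat /=.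
  by move: szQ => /=; lia.
split=> x.
  rewrite /= !inE !mem_cat !inE => /or3P[->//|->|/subQ]; first by rewrite orbT.
  by rewrite !inE => /orP[] ->; rewrite !orbT.
rewrite !inE mem_cat !inE => /or3P[->|->|/subD]; rewrite ?orbT //.
by rewrite inE => /orP[] ->; rewrite !orbT.
Qed.
End JoinedGraph.

(** * Cutting a sequence into nearly equal parts *)

Section Cut.
Variables (T : eqType) (Q : seq T) (k : nat).

(** Rounding multiples of [size Q / k] down keeps the lengths of the parts within one of each
    other. *)
Definition cut_point j := j * size Q %/ k.
Definition part j := take (cut_point j.+1 - cut_point j) (drop (cut_point j) Q).

Lemma leq_cut_point i j : i <= j -> cut_point i <= cut_point j.
Proof. by move=> ij; rewrite leq_div2r // leq_mul2r ij orbT. Qed.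

Lemma flatten_parts : 0 < k -> flatten [seq part j | j <- iota 0 k] = Q.
Proof.
move=> k0; have h j : flatten [seq part i | i <- iota 0 j] = take (cut_point j) Q.
  elim: j => [|j IH]; first by rewrite /cut_point mul0n div0n take0.
  rewrite -addn1 iotaD map_cat flatten_cat IH /= cats0 -takeD addn1.
  by rewrite subnKC // leq_cut_point.
by rewrite h /cut_point mulKn // take_size.
Qed.

Lemma size_part j : j < k -> size Q %/ k <= size (part j) <= size Q %/ k + 1.
Proof.
move=> jk; have k0 : 0 < k by apply: leq_ltn_trans jk.
have h : cut_point j.+1 <= size Q.
  by rewrite -[leqRHS](mulKn _ k0) leq_div2r // leq_mul2r jk orbT.
rewrite /part size_takel; last by rewrite size_drop leq_sub2r.
rewrite /cut_point mulSn; move: (size Q) (j * _) => y x.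
have := divn_eq x k; have := divn_eq y k; have := divn_eq (y + x) k.
have := ltn_pmod x k0; have := ltn_pmod y k0; have := ltn_pmod (y + x) k0.
move: (x %/ k) (y %/ k) ((y + x) %/ k) (x %% k) (y %% k) ((y + x) %% k) => a b c x' y' z' *.
have : a + b <= c by nia.
have : c <= a + b + 1 by nia.
lia.
Qed.

Lemma sorted_part (e : rel T) j : sorted e Q -> sorted e (part j).
Proof. by move=> sQ; apply/take_sorted/drop_sorted. Qed.
End Cut.

(** * Chains of pieces *)

Section Chain.
Variables (X V : eqType) (e : rel V) (y : X -> V) (piece : X -> seq V).

Definition chain_pred ini (L : seq X) s := last ini (map y (take (index s L) L)).

Lemma chain_path ini L : uniq L -> (forall s u, last u (piece s) = y s) ->
    (forall s, s \in L -> path e (chain_pred ini L s) (piece s)) ->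
  path e ini (flatten (map piece L)) /\ last ini (flatten (map piece L)) = last ini (map y L).
Proof.
move=> uL hlast; elim: L ini uL => [|x L IH] ini //= /andP[xL uL] hp.
rewrite cat_path last_cat hlast.
have [|-> ->] := IH (y x) uL.
  move=> s sL; have := hp s; rewrite inE sL orbT /chain_pred /= => /(_ isT).
  by case: (x =P s) => [xs|//]; rewrite xs sL in xL.
by have := hp x (mem_head _ _); rewrite /chain_pred /= eqxx /= => ->.
Qed.
End Chain.

Lemma injection_into (X V : finType) (A : {set V}) (v0 : V) : #|X| <= #|A| ->
  exists2 f : X -> V, injective f & forall x, f x \in A.
Proof.
move=> XA; have h (x : X) : enum_rank x < size (enum A).
  by rewrite -cardE; apply: leq_trans (ltn_ord _) XA.
exists (fun x : X => nth v0 (enum A) (enum_rank x)).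
  move=> x x' /eqP; rewrite nth_uniq ?enum_uniq // => /eqP /ord_inj; exact: enum_rank_inj.
by move=> x; rewrite -mem_enum mem_nth.
Qed.

Lemma uniq_flatten_map (X T : eqType) (F : X -> seq T) s : uniq (flatten (map F s)) ->
  (forall k, k \in s -> uniq (F k)) /\
  (forall k k' x, k \in s -> k' \in s -> x \in F k -> x \in F k' -> k = k').
Proof.
elim: s => //= a s IH; rewrite cat_uniq => /and3P[ua /hasPn hn /IH [IH1 IH2]].
have sep k x : k \in s -> x \in F a -> x \in F k -> False.
  move=> ks xa xk; suff /hn : x \in flatten (map F s) by rewrite /= xa.
  by apply/flattenP; exists (F k); rewrite ?map_f.
split=> [k|k k' x]; first by rewrite inE => /orP[/eqP ->|/IH1].
rewrite !inE => /orP[/eqP ->|ks] /orP[/eqP ->|k's] // xk xk'; last exact: IH2 xk xk'.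
  by case: (sep _ _ k's xk xk').
by case: (sep _ _ ks xk' xk).
Qed.

(** * Links of length 3 through the reserve *)

Section Reserve.
Variables (V K : finType) (G : sgraph V) (m0 q h e1 : nat) (zeta : K * 'I_q -> V).
Hypothesis Gjoined : joined m0 G.
Hypothesis zeta_inj : injective zeta.

Definition reserve := [set zeta z | z in [set: K * 'I_q]].
Definition hits (D : {set V}) k := #|[set r | zeta (k, r) \in D]|.
Definition spread (D : {set V}) := D \subset reserve /\ forall k, hits D k <= h.

Hypothesis reserve_deg : forall v, e1 <= #|[set w in reserve | G v w]|.
Hypothesis h_large : q + 75 <= 75 * h.

Lemma card_in_reserve (D : {set V}) : D \subset reserve -> #|D| = #|[set z | zeta z \in D]|.
Proof.
move=> DZ; rewrite -(card_imset _ zeta_inj); apply: eq_card => v; apply/idP/imsetP.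
  move=> vD; have /imsetP[z _ vz] := subsetP DZ _ vD.
  by exists z; rewrite ?inE -?vz.
by case=> z + ->; rewrite inE.
Qed.

Lemma sum_hits (D : {set V}) : D \subset reserve -> \sum_k hits D k = #|D|.
Proof.
move=> /card_in_reserve ->.
rewrite -[RHS]sum1_card (partition_big fst predT) //=; apply: eq_bigr => k _.
have pair_inj : injective (fun r : 'I_q => (k, r)) by move=> r r' [].
rewrite /hits -(card_imset _ pair_inj) sum1_card; apply: eq_card => -[k' r].
rewrite [RHS]unfold_in /= inE; apply/imsetP/andP => [[r' + [-> ->]]|[zD /eqP <-]].
  by rewrite inE.
by exists r; rewrite ?inE.
Qed.

(* Fibres that might not afford the two vertices of another link. *)
Let crowded (D : {set V}) := [set k | h <= hits D k + 1].

(** A crowded fibre has at least [h - 1] hits, and its [q] vertices number at most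
    [75 * (h - 1)]. *)
Lemma card_crowded D : spread D -> #|[set zeta z | z in [set z | z.1 \in crowded D]]| <= 75 * #|D|.
Proof.
move=> [DZ _]; rewrite card_imset //.
have -> : #|[set z : K * 'I_q | z.1 \in crowded D]| = #|crowded D| * q.
  rewrite -[in RHS](card_ord q) -[in RHS]cardsT -cardsX.
  by apply: eq_card => z; rewrite !inE andbT.
have : #|crowded D| * (h - 1) <= #|D|.
  rewrite -(sum_hits DZ) (bigID (mem (crowded D))) /= -sum_nat_const.
  apply: leq_trans (leq_addr _ _); apply: leq_sum => k; rewrite inE; lia.
by move: #|crowded D| #|D| => c d; nia.
Qed.

(** Avoiding [D] and the crowded fibres costs at most [76 * #|D|] reserve neighbours, so joinedness
    applies to what is left of the neighbourhoods of [u] and [w]. In an uncrowded fibre two more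
    hits are affordable. *)
Lemma link_in_reserve u w D : spread D -> 76 * #|D| + 2 * m0 <= e1 ->
  exists a b, [/\ a \notin D, b \notin D, a != b, path G u [:: a; b; w] & spread (a |: (b |: D))].
Proof.
move=> spD hD; have cc := card_crowded spD; set C := [set zeta z | z in _] in cc.
have free v : 2 * m0 <= #|[set x in reserve | G v x] :\: (D :|: C)|.
  set A := [set x in _ | _]; have := cardsID (D :|: C) A.
  have := subset_leq_card (subsetIr A (D :|: C)); have [+ _] := leq_card_setU D C.
  by have := reserve_deg v; rewrite -/A; lia.
have [||a [b [aA bB ab]]] := edge_between Gjoined (A := [set x in reserve | G u x] :\: (D :|: C))
  (B := [set x in reserve | G w x] :\: (D :|: C)); last 1 first.
- move: aA bB; rewrite !inE !negb_or => /andP[/andP[aD aC] /andP[aZ ua]] /andP[/andP[bD bC] /andP[bZ wb]].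
  exists a, b; split=> //; first exact: edgeN ab.
    by rewrite /= ua ab adj_sym wb.
  split.
    by case: spD => DZ _; apply/subsetP => x; rewrite !inE => /or3P[/eqP->|/eqP->|/(subsetP DZ)].
  move=> k; case: (boolP (k \in crowded D)) => kC.
    case: spD => _ /(_ k); apply: leq_trans; apply: subset_leq_card; apply/subsetP => r.
    rewrite !inE => /or3P[/eqP e|/eqP e|//].
      by case/negP: aC; apply/imsetP; exists (k, r); [rewrite inE|rewrite e].
    by case/negP: bC; apply/imsetP; exists (k, r); [rewrite inE|rewrite e].
  have fib c : #|[set r | zeta (k, r) == c]| <= 1.
    apply/card_le1P => r; rewrite inE => /eqP rc x; rewrite !inE -rc.
    by apply/eqP/eqP => [/zeta_inj[]|->].
  have := fib a; have := fib b; move: kC; rewrite inE -ltnNge.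
  have : hits (a |: (b |: D)) k <= #|[set r | zeta (k, r) == a]| + (#|[set r | zeta (k, r) == b]| + hits D k).
    apply: leq_trans (leq_add (leqnn _) (leq_card_setU _ _)).
    apply: leq_trans (leq_card_setU _ _); apply: subset_leq_card.
    by apply/subsetP => r; rewrite !inE.
  lia.
- by have := free u; lia.
- exact: free.
Qed.
End Reserve.

(** * Assembling the subdivision *)

Section Assembly.
Variables (V : finType) (G : sgraph V) (t : nat).

Notation edge_idx := {p : 'I_t * 'I_t | p.1 < p.2}.

(* The size bound forces the covering family to be disjoint, so that nothing else
   has to be checked about disjointness. *)
Lemma subdivision_of_cover (b : 'I_t -> V) (F : edge_idx -> seq V) (s0 : nat) :
    (forall k, path G (b (val k).1) (rcons (F k) (b (val k).2))) ->
    (forall v, v \in codom b \/ exists k, v \in F k) ->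
    t + \sum_k size (F k) <= #|V| ->
    (forall k, s0 <= size (F k) <= s0 + 2) ->
  exists S : subdivision (complete t) G, spanning S /\ nearly_balanced S.
Proof.
move=> hpath hcov hsz hs0.
pose L := codom b ++ flatten (map F (enum {: edge_idx})).
have uL : uniq L.
  apply: leq_size_uniq (enum_uniq V) _ _.
    move=> v _; rewrite mem_cat; case: (hcov v) => [->//|[k vk]].
    apply/orP; right; apply/flattenP; exists (F k) => //.
    by apply: map_f; rewrite mem_enum.
  have -> : size L = t + \sum_k size (F k); last by rewrite -cardE.
  rewrite size_cat size_codom card_ord size_flatten sumnE /shape -map_comp big_map.
  by rewrite big_enum.
move: uL; rewrite cat_uniq => /and3P[ub /hasPn hn /uniq_flatten_map[uF dF]].
have b_inj : injective b by apply/injectiveP.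
have bF i k : b i \notin F k.
  apply/negP => h; suff /hn : b i \in flatten (map F (enum {: edge_idx})) by rewrite /= codom_f.
  by apply/flattenP; exists (F k) => //; apply: map_f; rewrite mem_enum.
(* [F] is indexed by the pairs [i < j]; the opposite orientation gets the reversed sequence. *)
pose inn i j := if insub (i, j) is Some k then F k
                else if insub (j, i) is Some k then rev (F k) else [::] : seq V.
pose idx (i j : 'I_t) (ij : i < j) : edge_idx := exist _ (i, j) ij.
have insub_lt (i j : 'I_t) (ij : i < j) : insub (i, j) = Some (idx i j ij).
  exact: insubT.
have inn_lt (i j : 'I_t) (ij : i < j) : inn i j = F (idx i j ij).
  by rewrite /inn insub_lt.
have inn_rev (i j : 'I_t) : inn j i = rev (inn i j).
  case: (ltngtP i j) => ij.
  - rewrite /inn insubF //=; last by apply/negbTE; rewrite -leqNgt ltnW.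
    by rewrite insub_lt.
  - rewrite (inn_lt _ _ ij) /inn insubF /=; last by apply/negbTE; rewrite -leqNgt ltnW.
    by rewrite insub_lt revK.
  by rewrite /inn !insubF //= ?ij ltnn.
have inn_ex (i j : 'I_t) : i != j -> exists2 k : edge_idx, inn i j =i F k & [set (val k).1; (val k).2] = [set i; j].
  rewrite neq_ltn => /orP[] ij.
    by exists (idx i j ij); rewrite ?inn_lt.
  by exists (idx j i ij) => [x|]; rewrite 1?setUC // inn_rev inn_lt mem_rev.
have inn_size (i j : 'I_t) : i != j -> s0 <= size (inn i j) <= s0 + 2.
  rewrite neq_ltn => /orP[] ij; first by rewrite inn_lt.
  by rewrite inn_rev size_rev inn_lt.
have inn_path (i j : 'I_t) : i != j -> path G (b i) (rcons (inn i j) (b j)).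
  rewrite neq_ltn => /orP[] ij; first by rewrite inn_lt; apply: (hpath (idx i j ij)).
  have := hpath (idx j i ij); rewrite -inn_lt (inn_rev j i) /= => h.
  have := rev_path G (b j) (rcons (inn j i) (b i)).
  rewrite last_rcons belast_rcons rev_cons => ->.
  by rewrite (eq_path (e' := G)) // => x y; rewrite adj_sym.
have inn_uniq (i j : 'I_t) : i != j -> uniq (inn i j).
  rewrite neq_ltn => /orP[] ij; first by rewrite inn_lt uF ?mem_enum.
  by rewrite inn_rev rev_uniq inn_lt uF ?mem_enum.
have inn_branch i j w : i != j -> b w \notin inn i j.
  by move=> /inn_ex[k -> _]; apply: bF.
have inn_disj i j i' j' : i != j -> i' != j' -> [set i; j] != [set i'; j'] ->
    [disjoint inn i j & inn i' j'].
  move=> /inn_ex[k hk ek] /inn_ex[k' hk' ek']; rewrite -ek -ek' => kk'.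
  apply/pred0Pn => -[x /andP[/=]]; rewrite hk hk' => xk xk'.
  by case/eqP: kk'; rewrite (dF k k' x) ?mem_enum.
pose S := @Subdivision _ _ (complete t) G b inn b_inj (fun i j _ => inn_rev i j)
  inn_path inn_uniq (fun i j w h => inn_branch i j w h) inn_disj.
exists S; split.
  move=> v; case: (hcov v) => [/codomP[i ->]|[k vk]]; first by left; exists i.
  right; exists (val k).1, (val k).2; have kl := valP k; split.
    by rewrite /= /complete_rel neq_ltn kl.
  rewrite [inner _ _ _](_ : _ = inn (val k).1 (val k).2) // inn_lt.
  by rewrite (_ : idx _ _ _ = k) //; apply: val_inj => /=; case: (val k).
(* A length is one more than the number of inner vertices, so the lengths lie between [s0 + 1] and
   [s0 + 3]. *)
exists (s0 + 2); first by rewrite addn2.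
by move=> i j /inn_size; rewrite /branch_length /= -/(inn i j); lia.
Qed.
End Assembly.

(** * The construction under explicit numerical hypotheses *)

Section Core.
Variables (V : finType) (G : sgraph V) (m0 t d e0 : nat) (Z0 : {set V}) (v0 : V).
Hypothesis Gjoined : joined m0 G.
Hypothesis t_ge2 : 2 <= t.
Hypothesis deg_ge : forall v, d <= deg G v.
Hypothesis reserve0_deg : forall v, e0 <= #|[set w in Z0 | G v w]|.
Hypothesis Z0_small : 53 * #|Z0| + t + 2 * m0 + t * t <= d.
Hypothesis e0_large : 500 * m0 + 400 * (t * t) <= e0.

Notation K := {p : 'I_t * 'I_t | p.1 < p.2}.

Lemma nearly_balanced_spanning :
  exists S : subdivision (complete t) G, spanning S /\ nearly_balanced S.
Proof.
have t0 : 0 < t by lia.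
have k0 : K by exists (Ordinal t0, Ordinal t_ge2).
pose kk := #|{: K}|; have kk0 : 0 < kk by apply/card_gt0P; exists k0.
have kkt : kk <= t * t.
  rewrite /kk card_sig -[t in leqRHS]card_ord -card_prod; exact: max_card.
have dV : d <= #|V| by apply: leq_trans (deg_ge v0) (max_card _).
have eZ : e0 <= #|Z0|.
  apply: leq_trans (reserve0_deg v0) (subset_leq_card _).
  by apply/subsetP => w; rewrite inE => /andP[].
(* Fewer than [kk] vertices of [Z0] stay outside the fibres; they become ordinary vertices and lower
   the reserve degrees by at most [kk]. *)
pose q := #|Z0| %/ kk.
have xZ : kk * q <= #|Z0| by rewrite mulnC leq_trunc_div.
have Zx : #|Z0| < kk * q + kk by have := ltn_ceil #|Z0| kk0; rewrite -/q mulSn mulnC; lia.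
have q51 : 51 <= q by rewrite /q leq_divRL //; lia.
have cKq : #|{: K * 'I_q}| = kk * q by rewrite card_prod card_ord.
have [|zeta zeta_inj zetaZ] := @injection_into (K * 'I_q)%type V Z0 v0; first by rewrite cKq.
set Z := reserve zeta.
have ZZ0 : Z \subset Z0 by apply/subsetP => _ /imsetP[z _ ->].
have cZ : #|Z| = kk * q by rewrite card_imset // cardsT cKq.
have reserve_deg v : e0 - kk <= #|[set w in Z | G v w]|.
  have := reserve0_deg v; have := cardsID Z [set w in Z0 | G v w].
  have -> : [set w in Z0 | G v w] :&: Z = [set w in Z | G v w].
    apply/setP => w; rewrite !inE; case wZ: (w \in Z); rewrite ?andbF ?andbT //=.
    by rewrite (subsetP ZZ0).
  have : #|[set w in Z0 | G v w] :\: Z| <= #|Z0 :\: Z|.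
    by apply: subset_leq_card; apply/subsetP => w; rewrite !inE => /andP[-> /andP[->]].
  have := cardsID Z Z0; rewrite (setIidPr ZZ0) cZ; lia.
(* The largest value allowed by balancing; [q >= 51] makes it large enough for the links. *)
pose h := (q - 1) %/ 25.
have hq : 25 * h < q by have := leq_trunc_div (q - 1) 25; rewrite -/h; lia.
have qh : q + 75 <= 75 * h by rewrite /h; lia.
have [|b b_inj bZ] := @injection_into 'I_t V (~: Z0) v0.
  by rewrite card_ord; have := cardsC Z0; lia.
pose B := [set b i | i in 'I_t].
have cD0 : #|Z :|: B| = kk * q + t.
  rewrite cardsU cZ card_imset // card_ord (_ : Z :&: B = set0) ?cards0 ?subn0 //.
  apply/setP => w; rewrite !inE; apply/andP => -[wZ /imsetP[i _ wi]].
  by have := bZ i; rewrite inE -wi (subsetP ZZ0 _ wZ).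
have [tau expander] := expander_exists K.
(* Insertion slots of a path: [zof (k, s)] is the only reserve vertex that may fill slot [s] of path
   [k]. *)
pose X := (option 'I_12 * 'I_q)%type.
have cX : #|{: X}| = 13 * q by rewrite card_prod card_option !card_ord.
have cI : #|{: K * X}| = 13 * (kk * q) by rewrite card_prod cX -/kk mulnCA.
pose zof (p : K * X) := zeta ((option_perm tau p.2.1)^-1%g p.1, p.2.2).
(* The number 53 counts the reserve once and, for each of its vertices, 13 slots with 4 chain
   vertices each. *)
have free v (D : {set V}) : #|D| <= 53 * (kk * q) + t -> 2 * m0 <= #|[set w | G v w] :\: D|.
  move=> hD; have := deg_ge v; rewrite /deg.
  have := cardsID D [set w | G v w].
  have := subset_leq_card (subsetIr [set w | G v w] D); lia.
(* The private edges, chosen in the neighbourhoods of the vertices to be inserted. *)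
have [||phi1 [hphi1 _ cphi1]] := @greedy_pairs V (K * X)%type v0
    (fun p u w => [/\ G (zof p) u, G (zof p) w & G u w]) (fun=> True) (Z :|: B) => //.
  move=> p D _ _; rewrite cD0 cI => hD.
  have hA := @free (zof p) D; have [||x [y [xA yA xy]]] :=
    edge_between Gjoined (A := [set w | G (zof p) w] :\: D) (B := [set w | G (zof p) w] :\: D).
  - by apply: leq_trans (hA _); lia.
  - by apply: hA; lia.
  move: xA yA; rewrite !inE => /andP[xD zx] /andP[yD zy].
  by exists x, y; split=> //; apply: edgeN xy.
rewrite cD0 cI in cphi1; set D1 := _ :|: pairs_support _ in cphi1.
pose y1 k s := (phi1 (k, s : X)).2.
pose prevv (p : K * X) := chain_pred (y1 p.1) (b (val p.1).1) (enum {: X}) p.2.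
(* Two vertices linking each private edge to the end of the preceding one, or to the branch
   vertex. *)
have [||phi2 [hphi2 _ cphi2]] := @greedy_pairs V (K * X)%type v0
    (fun p u w => path G (prevv p) [:: u; w; (phi1 p).1]) (fun=> True) D1 => //.
  move=> p D _ _; rewrite cphi1 cI => hD.
  have hA v := @free v D; have [||x [y [xA yA xy]]] :=
    edge_between Gjoined (A := [set w | G (prevv p) w] :\: D) (B := [set w | G (phi1 p).1 w] :\: D).
  - by apply: leq_trans (hA _ _); lia.
  - by apply: hA; lia.
  move: xA yA; rewrite !inE => /andP[xD zx] /andP[yD zy].
  exists x, y; split=> //; first exact: edgeN xy.
  by rewrite /= zx xy adj_sym zy.
rewrite cphi1 cI in cphi2; set D2 := _ :|: pairs_support _ in cphi2.
pose W := ~: D2.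
have cW : #|W| + (53 * (kk * q) + t) = #|V| by have := cardsC D2; rewrite -/W; lia.
(* The budget is [6 * m0] for joining at most [3 * m0] covering paths and [4 * kk] for two links in
   each of the [kk] branching paths. *)
have link u w (D : {set V}) : spread h zeta D -> #|D| + 2 <= 6 * m0 + 4 * kk ->
    exists a b, [/\ a \notin D, b \notin D, a != b, path G u [:: a; b; w] &
      spread h zeta (a |: (b |: D))].
  move=> spD hD; apply: (link_in_reserve Gjoined zeta_inj reserve_deg) => //; lia.
have [ps [hps psW szps]] := path_cover Gjoined W.
have spread0 : spread h zeta set0.
  split=> [|k]; first exact: sub0set.
  by rewrite /hits (_ : [set r | _] = set0) ?cards0 //; apply/setP => r; rewrite !inE.
have [||Q [DQ [sQ spQ cDQ szQ [psQ DQQ]]]] := join_pieces (bound := 6 * m0) spread0 _ hps.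
- by move=> u w D spD hD; apply: link => //; lia.
- lia.
rewrite (perm_size psW) -cardE in szQ.
have WQ v : v \in W -> v \in Q.
  by move=> vW; apply: psQ; rewrite (perm_mem psW) mem_enum.
pose S (k : K) := part Q kk (enum_rank k).
have S_size k : size Q %/ kk <= size (S k) <= size Q %/ kk + 1.
  exact: size_part (ltn_ord (enum_rank k)).
have QS v : v \in Q -> exists k, v \in S k.
  rewrite -{1}(flatten_parts Q kk0) => /flattenP[s /mapP[j]].
  rewrite mem_iota add0n /= => jk -> vs; exists (enum_val (Ordinal jk)).
  by rewrite /S enum_valK.
(* The summand [t * t] in [Z0_small] leaves at least [kk] vertices in [W]. *)
have S_nonempty k : S k != [::].
  rewrite -size_eq0 -lt0n; case/andP: (S_size k) => + _; apply: leq_trans.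
  by rewrite divn_gt0 //; lia.
have sumS : \sum_k size (S k) = size Q.
  rewrite -[in RHS](flatten_parts Q kk0) size_flatten sumnE /shape -map_comp big_map.
  have -> : iota 0 kk = index_iota 0 kk by rewrite /index_iota subn0.
  rewrite big_mkord.
  by rewrite (reindex enum_rank) //=; apply: onW_bij; apply: enum_rank_bij.
pose endA (k : K) := last (b (val k).1) (map (y1 k) (enum {: X})).
pose src (p : K * bool) := if p.2 then endA p.1 else last v0 (S p.1).
pose tgt (p : K * bool) := if p.2 then head v0 (S p.1) else b (val p.1).2.
(* [true] links the chain to the part [S k], and [false] links this part to the final branch
   vertex. *)
have [||phi4 [hphi4 spD4 cphi4]] := @greedy_pairs V (K * bool)%type v0
    (fun p u w => path G (src p) [:: u; w; tgt p]) (spread h zeta) DQ => //.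
  move=> p D spD _; rewrite card_prod card_bool -/kk => hD.
  by apply: link => //; lia.
rewrite card_prod card_bool -/kk in cphi4; set D4 := _ :|: pairs_support _ in cphi4 spD4.
pose hit (z : K * 'I_q) := zeta z \in D4.
have [f hf] := @balanced_exists K tau q h hit expander (proj2 spD4) hq.
pose home k (s : X) := ((option_perm tau s.1)^-1%g k, s.2).
pose filled k (s : X) := ~~ hit (home k s) && (f (home k s) == s.1).
pose piece k (s : X) := [:: (phi2 (k, s)).1; (phi2 (k, s)).2; (phi1 (k, s)).1] ++
  (if filled k s then [:: zof (k, s)] else [::]) ++ [:: y1 k s].
pose F k := flatten (map (piece k) (enum {: X})) ++
  [:: (phi4 (k, true)).1; (phi4 (k, true)).2] ++ S k ++
  [:: (phi4 (k, false)).1; (phi4 (k, false)).2].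
(* A vertex [z] inserted into path [k] fills exactly the slot [(f z, z.2)]. *)
have load_filled k : load tau hit f k = \sum_s filled k s.
  have -> : \sum_s filled k s = #|[set s | filled k s]|.
    by rewrite -sum1_card [RHS]big_mkcond; apply: eq_bigr => s _; rewrite inE; case: (filled _ _).
  rewrite /load -(@card_in_imset _ _ (fun z => (f z, z.2))); last first.
    move=> z z'; rewrite !inE => /andP[_ /eqP dz] /andP[_ /eqP dz'] [ef e2].
    have e1 : z.1 = z'.1.
      apply: (@perm_inj _ (option_perm tau (f z))); rewrite {2}ef.
      exact: etrans dz (esym dz').
    by rewrite (surjective_pairing z) (surjective_pairing z') e1 e2.
  apply: eq_card => s; rewrite [RHS]inE; apply/imsetP/andP => [[z]|[hs /eqP fs]].
    rewrite inE => /andP[hz /eqP dz] ->.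
    have -> : home k (f z, z.2) = z.
      by rewrite /home /= -dz /dest permK -surjective_pairing.
    by rewrite /= eqxx.
  exists (home k s); first by rewrite inE hs /dest fs /home /= permKV eqxx.
  by rewrite fs /home /=; case: (s).
(* [52 * q] is 4 fixed vertices for each of the [13 * q] slots; the extra 4 are the two final
   links. *)
have F_size k : size (F k) = 52 * q + load tau hit f k + 4 + size (S k).
  have piece_size s : size (piece k s) = 4 + filled k s by rewrite /piece /=; case: (filled _ _).
  rewrite /F !size_cat size_flatten sumnE /shape -map_comp big_map big_enum /=.
  rewrite (eq_bigr _ (fun s _ => piece_size s)) big_split /= sum_nat_const cX load_filled.
  rewrite (_ : \sum_(s in {: X}) filled k s = \sum_s filled k s) ?eq_bigl //; lia.
have sum_load_f : \sum_k load tau hit f k + #|D4| = kk * q.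
  rewrite (card_in_reserve zeta_inj (proj1 spD4)) -cKq -(cardsC [set z | zeta z \in D4]) addnC.
  congr (_ + _); have := sum_load tau hit f [set: K]; rewrite (eq_bigl xpredT) => [->|k]; last by rewrite inE.
  by apply: eq_card => z; rewrite in_setC [LHS]inE in_setT andbT [in RHS]inE.
(* Loads exceed the least one by at most one, and so do part sizes the quotient, whence a window of
   width two. *)
have [kmin _ hmin] := @arg_minnP _ k0 xpredT (load tau hit f) isT.
apply: (@subdivision_of_cover V G t b F (52 * q + 4 + size Q %/ kk + load tau hit f kmin)).
- move=> k; have [|||pc lc] := @chain_path _ _ G (y1 k) (piece k) (b (val k).1) (enum {: X}).
  + exact: enum_uniq.
  + by move=> s u; rewrite /piece !last_cat.
  + move=> s _; have := hphi2 (k, s); rewrite /prevv /= => /and4P[h1 h2 h3 _].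
    have [g1 g2 g3] := hphi1 (k, s).
    rewrite /piece /= h1 h2 h3 /=; case: (filled _ _) => /=; last by rewrite g3.
    by rewrite adj_sym g1 g2.
  rewrite /F rcons_cat cat_path pc lc -/(endA k) /=.
  have := hphi4 (k, true); have := hphi4 (k, false); rewrite /src /tgt /=.
  have : sorted G (S k) by apply: sorted_part.
  case: (S k) (S_nonempty k) => // w s _ /= sw.
  move=> /and4P[h1 h2 h3 _] /and4P[-> -> -> _] /=.
  by rewrite rcons_cat cat_path sw /= h1 h2 h3.
- move=> v.
  have inS : v \in Q -> exists k, v \in F k.
    by case/QS => k vk; exists k; rewrite /F !mem_cat vk !orbT.
  have in_piece k s : v \in piece k s -> exists k, v \in F k.
    move=> vs; exists k; rewrite /F mem_cat; apply/orP; left; apply/flattenP.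
    by exists (piece k s) => //; apply: map_f; rewrite mem_enum.
  have inD4 : v \in D4 -> exists k, v \in F k.
    rewrite inE => /orP[/DQQ/inS //|]; rewrite inE => /existsP[[k [] hv]]; exists k;
    by rewrite /F !mem_cat !inE; case/orP: hv => ->; rewrite ?orbT.
  case: (boolP (v \in D2)) => [|vW]; last by right; apply/inS/WQ; rewrite inE.
  rewrite !inE => /orP[/orP[/orP[/imsetP[z _ vz]|/imsetP[i _ ->]]|/existsP[[k s] hv]]|/existsP[[k s] hv]].
  + right; case: (boolP (hit z)) => hz; first by apply: inD4; rewrite vz.
    apply: (in_piece (dest tau f z) (f z, z.2)).
    have hz' : home (dest tau f z) (f z, z.2) = z.
      by rewrite /home /dest /= permK -surjective_pairing.
    rewrite /piece /filled hz' hz /= eqxx /= /zof /= -/(home (dest tau f z) (f z, z.2)) hz' vz.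
    by rewrite !inE eqxx !orbT.
  + by left; apply: codom_f.
  + right; apply: (in_piece k s); rewrite /piece !mem_cat !inE.
    by case/orP: hv => ->; rewrite !orbT.
  + right; apply: (in_piece k s); rewrite /piece !mem_cat !inE.
    by case/orP: hv => ->; rewrite ?orbT.
(* The count is exact: the spent vertices [D4] are missing from the loads, but [DQ] reappears in [Q]
   and the other [4 * kk] in the final links. *)
- have [c hc] : exists c, c = 52 * q by exists (52 * q).
  have F_size' k : size (F k) = c + load tau hit f k + 4 + size (S k) by rewrite hc.
  rewrite (eq_bigr _ (fun k _ => F_size' k)) !big_split /= !sum_nat_const sumS -/kk hc mulnCA.
  move: sum_load_f cW szQ cphi4; move: (\sum_i _) (kk * q) (size Q) #|W| #|DQ| #|D4| #|V| => x y z w1 w2 w3 w4; lia.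
- move=> k; rewrite F_size; have := S_size k; have := hmin k isT; have := hf k kmin; lia.
Qed.
End Core.

(** * Choice of the constants *)

Lemma linear_lt_exp C k : 2 * C + 2 <= k -> C * k.+1 < 2 ^ k.
Proof.
move=> hk; pose j := k./2.
have h1 : k.+1 <= 2 ^ j.+1.
  have : j < 2 ^ j by apply: ltn_expl.
  by rewrite /j expnS; lia.
have h2 : C < 2 ^ C by apply: ltn_expl.
(* Half of the exponent absorbs [k + 1] and the other half absorbs [C]. *)
apply: (@leq_trans (2 ^ (C + j.+1))); last by rewrite leq_exp2l // /j; lia.
rewrite expnD; apply: (@leq_ltn_trans (C * 2 ^ j.+1)); first by rewrite leq_mul2l h1 orbT.
by rewrite ltn_pmul2r // expn_gt0.
Qed.

Lemma small_class (V : finType) g (f : V -> 'I_g) : 0 < g ->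
  exists c, g * #|[set w | f w == c]| <= #|V|.
Proof.
move=> g0; have [c _ hc] := @arg_minnP _ (Ordinal g0) xpredT
  (fun c => #|[set w | f w == c]|) isT; exists c.
have -> : #|V| = \sum_c #|[set w | f w == c]|.
  rewrite -sum1_card (partition_big f predT) //=; apply: eq_bigr => c' _.
  by rewrite -sum1_card; apply: eq_bigl => w; rewrite inE.
rewrite -[X in X * _]card_ord -sum_nat_const; exact: leq_sum.
Qed.

(** Version with natural parameters: [M] plays the role of [1 / mu], and the [+ 1] allows for
    rounding up [eps * n]. *)
Lemma spanning_subdivision_nat M : 0 < M -> exists E n0, 0 < E /\
  forall (V : finType) (G : sgraph V) (m0 t : nat), n0 <= #|V| ->
    joined m0 G -> m0 <= #|V| %/ E + 1 -> (forall v, #|V| <= M * deg G v) ->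
    2 <= t -> t * t <= #|V| %/ E ->
  exists S : subdivision (complete t) G, spanning S /\ nearly_balanced S.
Proof.
(* As [2 * 53 <= 108], the smallest colour class uses at most half of the degree bound. [K0] gives
   reserve degree [k], the quotient of [n] by [K0], and [E] ensures [k >= 1500 * a], above
   [500 * m0 + 400 * (t * t) <= 1400 * a]. *)
move=> M0; pose g := 108 * M; pose K0 := 4 * g * M; pose E := 30 * 50 * K0.
pose C := K0 * g; exists E, (E + K0 * (2 * C + 2)); split; first by rewrite /E /K0 /g; nia.
move=> V G m0 t hn hj hm hdeg t2 ht.
have K00 : 0 < K0 by rewrite /K0 /g; nia.
have E0 : 0 < E by rewrite /E; lia.
set n := #|V| in hn hm hdeg ht *; pose k := n %/ K0; pose a := n %/ E.
have hk : 2 * C + 2 <= k by rewrite /k leq_divRL // mulnC; lia.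
have a1 : 0 < a by rewrite /a divn_gt0 //; lia.
have nE : E * a <= n by rewrite mulnC leq_trunc_div.
have nK : K0 * k <= n by rewrite mulnC leq_trunc_div.
have ka : 30 * 50 * a <= k by rewrite /k leq_divRL // mulnAC -/E.
have hexp : n * g < 2 ^ k.
  apply: leq_ltn_trans (linear_lt_exp hk).
  by rewrite /C mulnAC leq_mul2r mulnC ltnW ?orbT // ltn_ceil.
have g0 : 0 < g by rewrite /g; lia.
have hN v : 4 * g * k <= #|[set w | G v w]|.
  rewrite -(leq_pmul2l M0); apply: leq_trans (hdeg v); apply: leq_trans nK.
  by rewrite /K0 mulnA [M * _]mulnC.
have [f hf] := coloring_exists hN hexp g0.
have [c hc] := small_class f g0.
have [v0 _] : exists v0 : V, v0 \in V.
  by apply/card_gt0P; rewrite -/n; lia.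
apply: (@nearly_balanced_spanning V G m0 t (n %/ M) k [set w | f w == c] v0) => //.
- by move=> v; rewrite -ltnS ltn_divLR // mulnC; apply: leq_ltn_trans (hdeg v) _; rewrite ltn_pmul2l.
- move=> v; apply: leq_trans (hf v c) _; apply: subset_leq_card; apply/subsetP => w.
  by rewrite !inE andbC.
- rewrite leq_divRL //.
  move: hc nE ht hm; rewrite -/n -/a /E /K0 /g; move: #|[set w | _]| => z hc nE ht hm.
  have tt : t <= t * t by rewrite leq_pmull; lia.
  have : 53 * z + t + 2 * m0 + t * t <= 53 * z + 6 * a by lia.
  move=> hb; apply: leq_trans (leq_mul hb (leqnn M)) _.
  have h1 : 2 * (53 * z * M) <= n by lia.
  have h2 : 2 * (6 * a * M) <= n.
    have : a * M <= a * (M * M) by rewrite leq_mul2l leq_pmulr ?orbT.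
    lia.
  rewrite mulnDl; lia.
- lia.
Qed.

(** * Passage to real parameters *)

Import Order.TTheory GRing.Theory Num.Theory.
Local Open Scope ring_scope.

Lemma min_degree_le (V : finType) (G : sgraph V) v : (min_degree G <= deg G v)%N.
Proof.
rewrite /min_degree; have : v \in index_enum V by rewrite mem_index_enum.
elim: (index_enum V) => // u s IH; rewrite big_cons inE => /orP[/eqP <-|/IH h].
  exact: geq_minl.
exact: leq_trans (geq_minr _ _) h.
Qed.

Theorem theorem1p5 (R : realType) :
  forall mu : R, 0 < mu ->
  exists (c eps : R) (n0 : nat),
    [/\ 0 < c <= 1, 0 < eps <= 1 &
    forall n : nat, (n0 <= n)%N ->
    forall (V : finType) (G : sgraph V),
      #|V| = n ->
      joined (ceil_nat (eps * n%:R)) G ->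
      mu * n%:R <= (min_degree G)%:R ->
      forall t : nat, (2 <= t)%N -> t%:R <= c * Num.sqrt (n%:R : R) ->
      exists S : subdivision (complete t) G, spanning S /\ nearly_balanced S].
Proof.
move=> mu mu0; pose M := Num.bound mu^-1.
have hM : 1 < mu * M%:R.
  by rewrite mulrC -ltr_pdivrMr // div1r archi_boundP // invr_ge0 ltW.
have M0 : (0 < M)%N by case: M hM => //; rewrite mulr0 ltr10.
have [E [n0 [E0 H]]] := spanning_subdivision_nat M0.
have ER : 0 < E%:R :> R by rewrite ltr0n.
have c1 : 0 < (E%:R^-1 : R) <= 1.
  by rewrite invr_gt0 ER invf_le1 // ler1n.
exists E%:R^-1, E%:R^-1, n0; split=> // n hn V G cV hj hmu t t2 ht.
apply: (H V G _ t _ hj) => //; rewrite cV //.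
- have hceil : Num.ceil (E%:R^-1 * n%:R : R) <= (n %/ E + 1)%N%:Z.
    rewrite ceil_le_int mulrC ler_pdivrMr // -natrM ler_nat addn1 ltnW //.
    exact: ltn_ceil.
  have : 0 <= Num.ceil (E%:R^-1 * n%:R : R).
    by rewrite ceil_ge0; apply: lt_le_trans (_ : 0 <= _); rewrite ?ltrN10 // mulr_ge0 // ltW // invr_gt0.
  move: hceil; rewrite /ceil_nat; case: (Num.ceil _) => // j; rewrite lez_nat.
- move=> v; have : mu * n%:R <= (deg G v)%:R.
    by apply: le_trans hmu _; rewrite ler_nat min_degree_le.
  move=> hv; rewrite -(ler_nat R) natrM.
  have : n%:R <= mu * M%:R * n%:R :> R by rewrite ler_peMl // ltW.
  move/le_trans; apply; rewrite mulrAC [leRHS]mulrC; exact: ler_wpM2r.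
(* Squaring [E * t <= sqrt n] gives even [E ^ 2 * t ^ 2 <= n]. *)
- rewrite leq_divRL //.
  have h2 : (E * t)%:R <= Num.sqrt (n%:R : R).
    by rewrite natrM mulrC -ler_pdivlMr // mulrC.
  have : ((E * t)%:R : R) ^+ 2 <= n%:R.
    rewrite -[leRHS](@sqr_sqrtr R) ?ler0n //; apply: lerXn2r; rewrite ?nnegrE ?sqrtr_ge0 //.
  rewrite -natrX ler_nat; apply: leq_trans; rewrite -mulnn; nia.
Qed.
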